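(* Let $H\in(1/2,1)$ and let $K$ be the fractional Brownian kernel with Hurst index $H$. For the functional $f(x)=\sup_{t\in[0,1]}\left(\int_0^t (K(t,s)-x(s))^2\,ds\right)^{1/2}$ on $L_2([0,1])$ there is a unique minimizing function, i.e. there is exactly one element $a\in L_2([0,1])$ with $f(a)=\min_{x\in L_2([0,1])}f(x)$.
   Context: For $H\in(1/2,1)$ put $\alpha=H-1/2$ and $C_\alpha=\alpha\left(\frac{(2\alpha+1)\Gamma(1-\alpha)}{\Gamma(\alpha+1)\Gamma(1-2\alpha)}\right)^{1/2}$, where $\Gamma$ is the Gamma function. The fractional Brownian kernel is $K(t,s)=C_\alpha s^{-\alpha}\int_s^t u^\alpha(u-s)^{\alpha-1}\,du$ for $0<s<t\le1$, and $K(t,s)=0$ for all other $t,s\in[0,1]$. Elements of $L_2([0,1])$ (real-valued) are identified when they agree almost everywhere with respect to Lebesgue measure. *)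

(* Defs.v *)
From mathcomp Require Import all_boot all_order all_algebra.
From mathcomp Require Import all_classical all_reals all_analysis.

Set Implicit Arguments.
Unset Strict Implicit.
Unset Printing Implicit Defensive.

Import Order.TTheory GRing.Theory Num.Theory.
Import numFieldNormedType.Exports.

Local Open Scope classical_set_scope.
Local Open Scope ring_scope.

(* Euler's integral; it is the Gamma function for [0 < x], and only such
   arguments occur below. *)
Definition Gamma (R : realType) (x : R) : R :=
  \int[@lebesgue_measure R]_(u in `]0%R, +oo[) (u `^ (x - 1) * expR (- u)).

Definition fbm_const (R : realType) (alpha : R) : R :=
  alpha * Num.sqrt (((2 * alpha + 1) * Gamma (1 - alpha)) /
                    (Gamma (alpha + 1) * Gamma (1 - 2 * alpha))).

(* The fractional Brownian kernel with Hurst index [H]; the integrand is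
   nonnegative and, for [1/2 < H], integrable, so the real-valued integral
   is the genuine one. *)
Definition fbm_kernel (R : realType) (H : R) (t s : R) : R :=
  let alpha := H - 2^-1 in
  if (0 < s) && (s < t) && (t <= 1) then
    fbm_const alpha * s `^ (- alpha) *
    \int[@lebesgue_measure R]_(u in `[s, t])
      (u `^ alpha * (u - s) `^ (alpha - 1))
  else 0.

Definition lebesgue01 (R : realType) :
    {measure set (measurableTypeR R) -> \bar R} :=
  mrestr (@lebesgue_measure R) (measurable_itv `[0%R, 1%R]).

(* Functions on [0, 1] are encoded as functions on [R] up to equality almost
   everywhere for Lebesgue measure restricted to [0, 1], so the values outside
   [0, 1] are irrelevant.  Elements of this type are equivalence classes,
   coerced to functions through a chosen representative. *)
Definition L2_01 (R : realType) : Type := LspaceType (lebesgue01 R) (lee1n 2).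

(* The integral and the supremum are taken in the extended reals, so that no
   default value is involved; [f x] does not depend on the representative
   of [x]. *)
Definition fbm_dist (R : realType) (H : R) (x : R -> R) : \bar R :=
  ereal_sup [set sqrte (\int[@lebesgue_measure R]_(s in `[0%R, t])
                          (((fbm_kernel H t s - x s) ^+ 2)%:E))%E
            | t in `[0%R, 1%R]].

(* Main.v *)
Require Import Defs.
From HB Require Import structures.
From mathcomp Require Import all_boot all_order all_algebra.
From mathcomp Require Import all_classical all_reals all_analysis.
From mathcomp Require Import measurable_realfun ring lra.

(** The functional is [sqrte] of
      [sq_dist x = sup_t \int_0^t (K(t,s) - x(s))^2 ds],
    so it suffices to minimise [sq_dist]. Let [m] be its infimum over square
    integrable functions.

    A supremum of squared distances is convex but need not be strictly convex:
    the parallelogram identity at the midpoint [z] of [x] and [y] gains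
    [1/4 \int_0^t (x - y)^2], which says nothing beyond [t] if the supremum
    for [z] is approached at [t < 1]. Self-similarity of the kernel,
    [K(l t, l s) = l^(H - 1/2) K(t, s)], rules that out. For [l < 1], the
    function equal to [l^(H - 1/2) z(s / l)] for [s <= l] and to [0] beyond has,
    at times [t <= l], squared distances [l^(2H)] times those of [z]; at times
    [t > l] its squared distance exceeds that of [z] at time [1] by an amount
    controlled by [\int_0^1 (K(1,s) - K(l,s))^2 ds], which tends to [0] as
    [l -> 1]. If the squared distance of [z] at time [1] were below [m], a
    suitable [l] would therefore push [sq_dist] below [m]. Hence almost
    minimisers almost attain [m] at time [1] ([endpoint_gap]), and the
    parallelogram identity at [t = 1] shows that two almost minimisers are
    close in [L^2([0, 1])] ([near_minimizers_close]).

    Uniqueness follows at once. For existence, a minimising sequence is Cauchy;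
    chosen with geometrically small increments it converges almost everywhere
    ([sqnorm_cauchy_ae_cvg]), and by Fatou's lemma the limit is a minimiser
    ([sqnorm_fatou]).

    What is needed of the kernel comes from the substitution [u = s v], which
    gives [K(t, s) = C s^(H - 1/2) Phi(t / s)] with [Phi] nondecreasing and
    continuous ([fbm_kernelE]): measurability, monotonicity in [t],
    self-similarity, square integrability and left-continuity in [L^2] at
    [t = 1]. *)

Set Implicit Arguments.
Unset Strict Implicit.
Unset Printing Implicit Defensive.
Import Order.TTheory GRing.Theory Num.Theory.
Import numFieldNormedType.Exports.
Local Open Scope classical_set_scope.
Local Open Scope ring_scope.

(** * Dilations of the Lebesgue measure *)

(** By uniqueness of the Lebesgue measure: [l] times its image under [x |-> l x]
    also gives length to intervals. *)
Lemma ge0_integral_dilation (R : realType) (l : R) (D : set R)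
    (f : R -> \bar R) : 0 < l -> measurable D -> measurable_fun D f ->
  (forall x, D x -> (0 <= f x)%E) ->
  (\int[@lebesgue_measure R]_(x in D) f x =
   l%:E * \int[@lebesgue_measure R]_(x in [set x | D (l * x)%R]) f (l * x)%R)%E.
Proof.
move=> l0 mD mf f0.
have mphi : measurable_fun [set: measurableTypeR R]
    (fun x : R => (l * x)%R : measurableTypeR R).
  by apply: measurable_funM => //; exact: measurable_cst.
pose nu0 : measure (measurableTypeR R) R :=
  mscale (NngNum (ltW l0)) (pushforward (@lebesgue_measure R)
    (fun x : measurableTypeR R => (l * x)%R : measurableTypeR R)).
pose nu := nu0 mphi.
have nuE A : measurable A -> @lebesgue_measure R A = nu A.
  apply: lebesgue_measure_unique => _ [[a b] _ <-].
  rewrite /nu /nu0/= /mscale /= /pushforward.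
  rewrite (_ : _ @^-1` _ = `]a / l, b / l]%classic); last first.
    apply/seteqP; split => x /=; rewrite !in_itv/=;
    by rewrite ltr_pdivrMr// ler_pdivlMr// mulrC.
  rewrite !lebesgue_measure_itv/= !lte_fin ltr_pM2r ?invr_gt0//.
  case: ifP => _; last by rewrite mule0.
  by rewrite -?EFinB -?EFinM; congr EFin; field; rewrite gt_eqF.
rewrite (@eq_measure_integral _ (measurableTypeR R) _ D nu); last first.
  by move=> A mA _; exact: nuE.
rewrite ge0_integral_mscale// ge0_integral_pushforward//.
by move=> y; rewrite inE => /f0.
Qed.

(** * Square norms on initial intervals *)

Section SqNorm.
Context {R : realType}.
Local Notation mu := (@lebesgue_measure R).
Implicit Types (f g h : R -> R) (t u c : R).

(** Extended-real valued, so that the identities below hold without any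
    integrability hypothesis. *)
Definition sqnorm t h : \bar R :=
  (\int[mu]_(s in `[0%R, t]) ((h s ^+ 2)%:E))%E.

Lemma measurable_sq (D : set R) h : measurable_fun [set: R] h ->
  measurable_fun D (fun s => (h s ^+ 2)%:E).
Proof.
by move=> mh; apply: measurable_funTS; apply/measurable_EFinP;
  exact: measurable_funX.
Qed.
Hint Resolve measurable_sq : core.

Lemma sq_ge0 h (s : R) : (0 <= (h s ^+ 2)%:E)%E.
Proof. by rewrite lee_fin sqr_ge0. Qed.
Hint Resolve sq_ge0 : core.

Lemma sqnorm_ge0 t h : (0 <= sqnorm t h)%E.
Proof. by apply: integral_ge0. Qed.

Lemma le_sqnorm t f g :
  measurable_fun [set: R] f -> measurable_fun [set: R] g ->
  (forall s, 0 <= s <= t -> f s ^+ 2 <= g s ^+ 2) ->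
  (sqnorm t f <= sqnorm t g)%E.
Proof.
by move=> mf mg fg; apply: ge0_le_integral => //; exact: measurable_sq.
Qed.

Lemma eq_sqnorm t f g : (forall s, 0 <= s <= t -> f s = g s) ->
  sqnorm t f = sqnorm t g.
Proof.
by move=> fg; apply: eq_integral => s; rewrite inE/= in_itv/= => /fg ->.
Qed.

Lemma sqnorm_subset t u h : measurable_fun [set: R] h -> t <= u ->
  (sqnorm t h <= sqnorm u h)%E.
Proof.
move=> mh tu; apply: ge0_subset_integral => //.
  exact: measurable_sq.
by move=> s /=; rewrite !in_itv/= => /andP[-> /le_trans]; exact.
Qed.

Lemma sqnormZ t c h : measurable_fun [set: R] h ->
  sqnorm t (fun s => c * h s)%R = ((c ^+ 2)%:E * sqnorm t h)%E.
Proof.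
move=> mh; rewrite /sqnorm -ge0_integralZl//.
- by apply: eq_integral => s _; rewrite exprMn EFinM.
- exact: measurable_sq.
- by rewrite lee_fin sqr_ge0.
Qed.

Lemma sqnormN t h : sqnorm t (fun s => - h s)%R = sqnorm t h.
Proof. by apply: eq_integral => s _; rewrite sqrrN. Qed.

Lemma sqnorm0 t : sqnorm t (fun=> 0) = 0%E.
Proof.
by rewrite /sqnorm; under eq_integral do rewrite expr0n/=; rewrite integral0.
Qed.

Lemma sqnorm_midpoint t (k f g : R -> R) :
  measurable_fun [set: R] k -> measurable_fun [set: R] f ->
  measurable_fun [set: R] g ->
  (sqnorm t (fun s => k s - (f s + g s) / 2)%R +
   4^-1%:E * sqnorm t (fun s => f s - g s)%R =
   2^-1%:E * (sqnorm t (fun s => k s - f s)%R + sqnorm t (fun s => k s - g s)%R))%E.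
Proof.
move=> mk mf mg.
have mkf : measurable_fun [set: R] (fun s => k s - f s).
  exact: measurable_funB.
have mkg : measurable_fun [set: R] (fun s => k s - g s).
  exact: measurable_funB.
have mfg : measurable_fun [set: R] (fun s => f s - g s).
  exact: measurable_funB.
have mz : measurable_fun [set: R] (fun s => k s - (f s + g s) / 2).
  by apply: measurable_funB => //; apply: measurable_funM => //;
     apply: measurable_funD.
rewrite /sqnorm -ge0_integralZl//; last exact: measurable_sq.
rewrite -!ge0_integralD//; try exact: measurable_sq.
- rewrite -ge0_integralZl//.
  + apply: eq_integral => s _.
    by rewrite -?EFinM -?EFinD -?EFinM -?EFinD; congr EFin; field.
  + by apply: emeasurable_funD; exact: measurable_sq.
  + by move=> s _; rewrite adde_ge0.
- by move=> s _; rewrite mule_ge0.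
- by apply: measurable_funeM; exact: measurable_sq.
Qed.

(** [2 f g <= f^2 / e + e g^2] lets a perturbation [f] of small norm change the
    square norm of [g] by a factor as close to [1] as wanted. *)
Lemma sqnorm_young t e f g : 0 < e ->
  measurable_fun [set: R] f -> measurable_fun [set: R] g ->
  (sqnorm t (fun s => f s + g s)%R <=
   (1 + e^-1)%:E * sqnorm t f + (1 + e)%:E * sqnorm t g)%E.
Proof.
move=> e0 mf mg.
have ei0 : 0 < e^-1 by rewrite invr_gt0.
rewrite /sqnorm -!ge0_integralZl//; try exact: measurable_sq.
- rewrite -ge0_integralD//.
  + apply: ge0_le_integral => //.
    * by apply: measurable_sq; exact: measurable_funD.
    * by apply: emeasurable_funD; apply: measurable_funeM; exact: measurable_sq.
    * move=> s _; rewrite -!EFinM -EFinD lee_fin.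
      rewrite -subr_ge0 (_ : _ - _ = e * (e^-1 * f s - g s) ^+ 2).
        by rewrite mulr_ge0 ?sqr_ge0 ?ltW.
      by field; rewrite gt_eqF.
  + by move=> s _; rewrite mule_ge0// lee_fin addr_ge0 // ltW.
  + by apply: measurable_funeM; exact: measurable_sq.
  + by move=> s _; rewrite mule_ge0// lee_fin addr_ge0 // ltW.
  + by apply: measurable_funeM; exact: measurable_sq.
- by rewrite lee_fin addr_ge0 // ltW.
- by rewrite lee_fin addr_ge0 // ltW.
Qed.

Lemma sqnorm_dilation t c h : 0 < c -> measurable_fun [set: R] h ->
  sqnorm t h = (c%:E * sqnorm (t / c) (fun s => h (c * s))%R)%E.
Proof.
move=> c0 mh; rewrite /sqnorm (ge0_integral_dilation c0)//.
- congr (_ * _)%E; congr (integral _ _ _); apply/seteqP; split => s /=;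
  by rewrite !in_itv/= (ler_pdivlMr _ _ c0) [s * c]mulrC pmulr_rge0.
- exact: measurable_sq.
Qed.

Lemma ae_eq_sqnorm t f g :
  measurable_fun [set: R] f -> measurable_fun [set: R] g ->
  {ae mu, forall s, 0 <= s <= t -> f s = g s} -> sqnorm t f = sqnorm t g.
Proof.
move=> mf mg fg; apply: ge0_ae_eq_integral => //.
- exact: measurable_sq.
- exact: measurable_sq.
- move: fg; apply: (@filterS _ _ (ae_filter_ringOfSetsType mu)) => s /= fg.
  by rewrite in_itv/= => /fg ->.
Qed.

Lemma sqnorm_eq0 t h : measurable_fun [set: R] h ->
  sqnorm t h = 0%E -> {ae mu, forall s, 0 <= s <= t -> h s = 0}.
Proof.
move=> mh h0.
have : (\int[mu]_(s in `[0%R, t]) `|(h s ^+ 2)%:E| = 0)%E.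
  by under eq_integral do rewrite gee0_abs//.
have m1 : measurable (`[0, t]%classic : set (measurableTypeR R)) by [].
move/(ae_eq_integral_abs mu m1 (measurable_sq mh)).
apply: (@filterS _ _ (ae_filter_ringOfSetsType mu)) => s /= hs st.
have /hs : s \in `[0, t] by rewrite in_itv/=.
by case=> /eqP; rewrite sqrf_eq0 => /eqP.
Qed.

Lemma sqnorm_support t u h : measurable_fun [set: R] h -> t <= u ->
  (forall s, t < s <= u -> h s = 0) -> sqnorm u h = sqnorm t h.
Proof.
move=> mh tu h0; rewrite /sqnorm [RHS]integral_mkcond [LHS]integral_mkcond.
apply: eq_integral => s _; rewrite !patchE !mem_setE !in_itv/=.
case: (leP 0 s) => //= _; case: (leP s t) => st; first by rewrite (le_trans st).
by case: leP => // su; rewrite h0 ?st ?su// expr0n.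
Qed.

End SqNorm.

(** * An integrable power singularity *)

Section Power.
Context {R : realType}.
Local Notation mu := (@lebesgue_measure R).

Lemma is_derive_powR_sub (a p u : R) : p != 0 -> a < u ->
  is_derive u (1:R) (fun v : R => (v - a) `^ p / p) ((u - a) `^ (p - 1)).
Proof.
move=> p0 au.
have ua : 0 < u - a by rewrite subr_gt0.
have d1 : is_derive u (1:R) (fun v : R => v - a) 1.
  by rewrite -[X in is_derive _ _ _ X]subr0; apply: is_deriveB.
have d2 : is_derive u (1:R) (powR (R:=R) ^~ p \o (fun v => v - a))
    (p * (u - a) `^ (p - 1) * 1).
  apply: (@is_derive1_comp _ (powR (R:=R) ^~ p) (fun v => v - a)).
  exact: is_derive1_powR.
have -> : (fun v : R => (v - a) `^ p / p) =
   p^-1 \*: (powR (R:=R) ^~ p \o (fun v => v - a)).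
  by apply/funext => v /=; rewrite mulrC.
have -> : (u - a) `^ (p - 1) = p^-1 *: (p * (u - a) `^ (p - 1) * 1).
  by rewrite mulr1 scalerA mulVf// scale1r.
exact: is_deriveZ.
Qed.

(** The fundamental theorem of calculus away from the singularity [a]; the
    bound does not depend on [c], so that [c] can tend to [a]. *)
Lemma integral_powR_sub_away (a b c p : R) : 0 < p -> a < c -> c < b ->
  (\int[mu]_(u in `[c, b]) ((u - a) `^ (p - 1))%:E <=
   ((b - a) `^ p / p)%:E)%E.
Proof.
move=> p0 ac cb.
have p00 : p != 0 by rewrite gt_eqF.
have dF v : a < v ->
    is_derive v (1:R) (fun v : R => (v - a) `^ p / p) ((v - a) `^ (p - 1)).
  by move=> av; exact: is_derive_powR_sub.
have cF v : a < v -> {for v, continuous (fun v : R => (v - a) `^ p / p)}.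
  move=> av; apply: differentiable_continuous; apply/derivable1_diffP.
  by have [] := dF _ av.
rewrite (@continuous_FTC2 _ _ (fun v : R => (v - a) `^ p / p)).
- by rewrite -EFinB lee_fin gerBl mulr_ge0 ?powR_ge0// invr_ge0 ltW.
- by [].
- apply: derivable_within_continuous => v; rewrite in_itv/= => /andP[cv _].
  have av : 0 < v - a by rewrite subr_gt0 (lt_le_trans ac).
  have d1 : is_derive v (1:R) (fun v : R => v - a) 1.
    by rewrite -[X in is_derive _ _ _ X]subr0; apply: is_deriveB.
  by have [] := @is_derive1_comp _ (powR (R:=R) ^~ (p - 1)) (fun v => v - a)
    _ _ _ (is_derive1_powR (p - 1) av) d1.
- split.
  + move=> v; rewrite in_itv/= => /andP[cv _].
    by have [] := dF _ (lt_trans ac cv).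
  + by apply: cvg_at_right_filter; exact: cF.
  + by apply: cvg_at_left_filter; apply: cF; exact: lt_trans cb.
- move=> v; rewrite in_itv/= => /andP[cv _].
  by rewrite derive1E; have [_ ->] := dF _ (lt_trans ac cv).
Qed.

Lemma measurable_powR_sub (a p : R) (D : set R) :
  measurable_fun D (fun u : R => ((u - a) `^ p)).
Proof.
apply: measurable_funTS.
apply: (measurableT_comp (measurable_powR p)) => //.
exact: measurable_funB.
Qed.

Lemma integral_powR_sub_le (a b p : R) : 0 < p -> a <= b ->
  (\int[mu]_(u in `[a, b]) ((u - a) `^ (p - 1))%:E <=
   ((b - a) `^ p / p)%:E)%E.
Proof.
move=> p0; rewrite le_eqVlt => /predU1P[<-|ab].
  by rewrite set_itv1 integral_set1 lee_fin mulr_ge0 ?powR_ge0// invr_ge0 ltW.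
rewrite -integral_itv_obnd_cbnd; last first.
  by apply/measurable_EFinP; exact: measurable_powR_sub.
pose c (n : nat) : R := a + (b - a) / n.+2%:R.
have ba0 : 0 < b - a by rewrite subr_gt0.
have ac n : a < c n by rewrite ltrDl divr_gt0.
have cb n : c n < b.
  by rewrite /c -ltrBrDl ltr_pdivrMr// ltr_pMr// ltr1n.
pose F n : set R := `[c n, b]%classic.
have UF : \bigcup_n F n = `]a, b]%classic.
  apply/seteqP; split => u /=.
    move=> [n _]; rewrite /F/= !in_itv/= => /andP[cu ->].
    by rewrite andbT (lt_le_trans _ cu).
  rewrite in_itv/= => /andP[au ub].
  have ua : 0 < u - a by rewrite subr_gt0.
  pose n := Num.trunc ((b - a) / (u - a)).
  exists n => //; rewrite /F/= in_itv/= ub andbT /c -lerBrDl.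
  rewrite ler_pdivrMr// mulrC -ler_pdivrMr//.
  have := truncnS_gt ((b - a) / (u - a)).
  rewrite -/n => /ltW/le_trans; apply.
  by rewrite ler_nat.
have ndF : {homo F : n m / (n <= m)%N >-> (n <= m)%O}.
  move=> n m nm; rewrite subsetEset => u; rewrite /F/= !in_itv/=.
  move=> /andP[cu ->]; rewrite andbT (le_trans _ cu)// lerD2l.
  by rewrite ler_pM2l// lef_pV2 ?posrE// ler_nat !ltnS.
have mf n : measurable_fun (F n) (fun u : R => ((u - a) `^ (p - 1))%:E).
  by apply/measurable_EFinP; exact: measurable_powR_sub.
have := @ge0_nondecreasing_set_cvg_integral _ (measurableTypeR R) _ F
  (fun u : R => ((u - a) `^ (p - 1))%:E) mu ndF (fun=> measurable_itv _) mf.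
have f0 i x : F i x -> (0%R <= ((x - a) `^ (p - 1))%:E)%E.
  by move=> _; rewrite lee_fin powR_ge0.
move=> /(_ f0); rewrite UF => h.
rewrite -(cvg_lim _ h)//; apply: lime_le; first by apply/cvg_ex; eexists; exact: h.
by apply: nearW => n; exact: integral_powR_sub_away.
Qed.

End Power.

(** * The fractional Brownian kernel *)

Section Profile.
Context {R : realType}.
Local Notation mu := (@lebesgue_measure R).
Variable a : R.

Definition profile_density (s u : R) : R := u `^ a * (u - s) `^ (a - 1).

(** The kernel is homogeneous, so up to a power of [s] it depends only on the
    ratio [t / s], through this function. *)
Definition fbm_profile (r : R) : R :=
  \int[mu]_(v in `[1, r]) profile_density 1 v.

Lemma profile_density_ge0 s u : 0 <= profile_density s u.
Proof. by rewrite mulr_ge0 ?powR_ge0. Qed.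

Lemma measurable_profile_density s (D : set R) :
  measurable_fun D (profile_density s).
Proof.
apply: measurable_funM; last exact: measurable_powR_sub.
by apply: measurable_funTS; exact: measurable_powR.
Qed.

Hypothesis a0 : 0 < a.

Lemma integral_profile_density_le s t : 0 <= s <= t ->
  (\int[mu]_(u in `[s, t]) (profile_density s u)%:E <=
   (t `^ a * ((t - s) `^ a / a))%:E)%E.
Proof.
move=> /andP[s0 st].
have h := integral_powR_sub_le a0 st.
apply: (@le_trans _ _
  (\int[mu]_(u in `[s, t]) ((t `^ a)%:E * ((u - s) `^ (a - 1))%:E))%E).
  apply: ge0_le_integral => //.
  - by move=> u _; rewrite lee_fin profile_density_ge0.
  - by apply/measurable_EFinP; exact: measurable_profile_density.
  - by apply: measurable_funeM; apply/measurable_EFinP; exact: measurable_powR_sub.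
  - move=> u /=; rewrite in_itv/= => /andP[su ut].
    rewrite -EFinM lee_fin ler_wpM2r ?powR_ge0//.
    have u0 := le_trans s0 su.
    by apply: (ge0_ler_powR (ltW a0)); rewrite ?nnegrE// (le_trans u0).
rewrite ge0_integralZl//.
- by rewrite EFinM lee_wpmul2l// lee_fin powR_ge0.
- by apply/measurable_EFinP; exact: measurable_powR_sub.
- by move=> u _; rewrite lee_fin powR_ge0.
- by rewrite lee_fin powR_ge0.
Qed.

Lemma integrable_profile_density r :
  mu.-integrable `[1, r] (EFin \o profile_density 1).
Proof.
have [r1|r1] := leP 1 r; last first.
  by rewrite set_itv_ge -?leNgt ?bnd_simp//; exact: integrable_set0.
apply/integrableP; split.
  by apply/measurable_EFinP; exact: measurable_profile_density.
under eq_integral do rewrite gee0_abs ?lee_fin ?profile_density_ge0//.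
have := @integral_profile_density_le 1 r.
rewrite ler01 r1 => /(_ isT)/le_lt_trans; apply; exact: ltry.
Qed.

Lemma fbm_profile_ge0 r : 0 <= fbm_profile r.
Proof. by apply: Rintegral_ge0 => u _; exact: profile_density_ge0. Qed.

Lemma fbm_profileE r : (fbm_profile r)%:E =
  (\int[mu]_(v in `[1%R, r]) (profile_density 1 v)%:E)%E.
Proof.
rewrite /fbm_profile /Rintegral fineK//.
by apply: integrable_fin_num => //; exact: integrable_profile_density.
Qed.

Lemma fbm_profile_nd : {homo fbm_profile : r r' / r <= r'}.
Proof.
move=> r r' rr'; rewrite -lee_fin !fbm_profileE.
apply: ge0_subset_integral => //.
- by apply/measurable_EFinP; exact: measurable_profile_density.
- by move=> u _; rewrite lee_fin profile_density_ge0.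
- by move=> u /=; rewrite !in_itv/= => /andP[-> /le_trans]; exact.
Qed.

Lemma fbm_profile_eq0 r : r <= 1 -> fbm_profile r = 0.
Proof.
rewrite le_eqVlt => /predU1P[->|r1].
  by rewrite /fbm_profile set_itv1 Rintegral_set1.
by rewrite /fbm_profile set_itv_ge -?leNgt ?bnd_simp// Rintegral_set0.
Qed.

Lemma fbm_profile_le r : 1 <= r -> fbm_profile r <= r `^ a * ((r - 1) `^ a / a).
Proof.
move=> r1; rewrite -lee_fin fbm_profileE.
by apply: integral_profile_density_le; rewrite ler01.
Qed.

Lemma fbm_profile_continuous r : 1 < r -> {for r, continuous fbm_profile}.
Proof.
move=> r1.
have r1r : 1 < r + 1 by rewrite ltrDr (lt_trans ltr01).
have := parameterized_integral_continuous (ltW r1r) (integrable_profile_density _).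
move/(continuous_within_itvP _ r1r) => [+ _ _]; apply.
by rewrite in_itv/= r1 ltrDl ltr01.
Qed.

(** The substitution [u = s v]; [profile_density s] is homogeneous of degree
    [2 a - 1] in [(s, u)]. *)
Lemma integral_profile_density s t : 0 < s ->
  \int[mu]_(u in `[s, t]) profile_density s u = s `^ (2 * a) * fbm_profile (t / s).
Proof.
move=> s0; rewrite /Rintegral (ge0_integral_dilation s0)//; first last.
  by move=> u _; rewrite lee_fin profile_density_ge0.
  by apply/measurable_EFinP; exact: measurable_profile_density.
rewrite (_ : [set x | _] = `[1, t / s]%classic); last first.
  apply/seteqP; split => x /=; rewrite !in_itv/=;
  by rewrite ler_pdivlMr// [x * s]mulrC ler_pMr.
rewrite (eq_integral (fun x : measurableTypeR R =>
  (s `^ (2 * a - 1))%:E * (profile_density 1 x)%:E)%E); last first.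
  move=> x; rewrite inE/= in_itv/= => /andP[x1 _].
  have x0 : 0 <= x := le_trans ler01 x1.
  rewrite -EFinM /profile_density -[X in _ - X]mulr1 -mulrBr.
  rewrite !powRM ?subr_ge0 ?(ltW s0)//.
  rewrite (_ : 2 * a - 1 = a + (a - 1)); last by ring.
  rewrite (@powRD _ s a (a - 1)) ?(gt_eqF s0) ?implybT//; congr EFin; ring.
rewrite ge0_integralZl//; last 3 first.
- by apply/measurable_EFinP; exact: measurable_profile_density.
- by move=> u _; rewrite lee_fin profile_density_ge0.
- by rewrite lee_fin powR_ge0.
rewrite -fbm_profileE -!EFinM /= mulrA; congr (_ * _).
rewrite -{1}(powRr1 (ltW s0)) -powRD ?(gt_eqF s0) ?implybT//; congr powR; ring.
Qed.

End Profile.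

Section Kernel.
Context {R : realType}.
Local Notation mu := (@lebesgue_measure R).
Variable H : R.
Hypothesis hH : 2^-1 < H < 1.
Local Notation a := (H - 2^-1).
Local Notation K := (fbm_kernel H).
Local Notation C := (fbm_const a).

Let a0 : 0 < a. Proof. by case/andP : hH; rewrite subr_gt0. Qed.
Let a12 : a < 2^-1.
Proof. case/andP : hH => _ h; rewrite ltrBlDr (lt_le_trans h)//; lra. Qed.

Let C0 : 0 <= C.
Proof. by rewrite mulr_ge0 ?sqrtr_ge0// ltW. Qed.

Lemma fbm_kernelE t s : K t s =
  if (0 < s) && (t <= 1) then C * s `^ a * fbm_profile a (t / s) else 0.
Proof.
rewrite /fbm_kernel; case: ltP => s0 //=; case: (leP t 1) => t1; rewrite ?andbF//.
rewrite andbT; case: ltP => st.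
  rewrite -/(profile_density a s) (integral_profile_density a0 _ s0) mulrA.
  congr (_ * _); rewrite -mulrA -powRD ?(gt_eqF s0) ?implybT//.
  by congr (_ * powR _ _); ring.
by rewrite fbm_profile_eq0 ?mulr0// ler_pdivrMr// mul1r.
Qed.

Lemma fbm_kernel_ge0 t s : 0 <= K t s.
Proof.
rewrite fbm_kernelE; case: ifP => // _.
apply: mulr_ge0; last exact: fbm_profile_ge0.
by apply: mulr_ge0; [exact: C0|exact: powR_ge0].
Qed.

Lemma fbm_kernel_nd t u s : t <= u -> u <= 1 -> K t s <= K u s.
Proof.
move=> tu u1; rewrite !fbm_kernelE u1 (le_trans tu u1) !andbT.
case: ltP => // s0; apply: ler_wpM2l.
  by apply: mulr_ge0; [exact: C0|exact: powR_ge0].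
by apply: (fbm_profile_nd a0); rewrite ler_pM2r ?invr_gt0.
Qed.

Lemma fbm_kernel_eq0 t s : t <= s -> K t s = 0.
Proof.
by rewrite /fbm_kernel => ts; rewrite [s < t]ltNge ts/= andbF.
Qed.

Lemma fbm_kernel_selfsimilar c t s : 0 < c <= 1 -> t <= 1 ->
  K (c * t) (c * s) = c `^ a * K t s.
Proof.
move=> /andP[c0 c1] t1; rewrite !fbm_kernelE pmulr_rgt0// t1 andbT.
case: ltP => s0 /=; last by rewrite mulr0.
have -> : c * t <= 1.
  have [t0|t0] := leP 0 t; first by rewrite mulr_ile1// ltW.
  by rewrite (le_trans _ ler01)// pmulr_rle0// ltW.
rewrite (_ : c * t / (c * s) = t / s); last by field; rewrite !gt_eqF.
rewrite powRM ?ltW//; ring.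
Qed.

Lemma measurable_fbm_kernel t : measurable_fun [set: R] (K t).
Proof.
have [t1|t1] := leP t 1; last first.
  rewrite (_ : K t = cst 0); first exact: measurable_cst.
  by apply/funext => s; rewrite fbm_kernelE [t <= 1]leNgt t1 andbF.
rewrite (_ : K t = fun s =>
    if 0 < s then C * s `^ a * fbm_profile a (t * s `^ (-1)) else 0).
  apply: measurable_fun_ifT => //; first exact: measurable_fun_ltr.
  apply: measurable_funM.
    by apply: measurable_funM => //; exact: measurable_powR.
  have mphi : measurable_fun [set: R] (fbm_profile a).
    by apply: nondecreasing_measurable => //; exact: fbm_profile_nd.
  apply: (measurableT_comp mphi).
  by apply: measurable_funM => //; exact: measurable_powR.
apply/funext => s; rewrite fbm_kernelE t1 andbT.
by case: ltP => // s0; rewrite powR_inv1// ltW.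
Qed.

(** The square of this bound is integrable at [0] because [H < 1]. *)
Lemma fbm_kernel1_le s : 0 < s <= 1 -> K 1 s <= C / a * s `^ (- a).
Proof.
move=> /andP[s0 s1]; rewrite fbm_kernelE s0 lexx/=.
have s00 := ltW s0.
have si1 : 1 <= 1 / s by rewrite div1r invf_ge1.
have q0 : 0 < s `^ a by rewrite powR_gt0.
have sE : (1 / s) `^ a = (s `^ a)^-1.
  by rewrite div1r -(powR_inv1 s00) -powRrM mulN1r powRN.
have -> : C / a * s `^ (- a) = C * s `^ a * ((1 / s) `^ a * ((1 / s) `^ a / a)).
  rewrite sE powRN; move: (a) a0 => b b0.
  by field; rewrite (gt_eqF b0) gt_eqF// powR_gt0.
apply: ler_wpM2l; first by apply: mulr_ge0; [exact: C0|exact: ltW].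
apply: le_trans (fbm_profile_le a0 si1) _.
apply: ler_wpM2l; first exact: powR_ge0.
apply: ler_wpM2r; first by rewrite invr_ge0 ltW.
apply: (ge0_ler_powR (ltW a0)); rewrite ?nnegrE ?subr_ge0//.
- exact: le_trans ler01 si1.
- by rewrite gerBl.
Qed.

Lemma fbm_kernel1_L2 : (sqnorm 1 (K 1) < +oo)%E.
Proof.
pose f (s : R) := (s - 0) `^ (1 - 2 * a - 1).
have p0 : 0 < 1 - 2 * a by move: a12; lra.
have mf D : measurable_fun D (fun s => (f s)%:E).
  by apply/measurable_EFinP; exact: measurable_powR_sub.
have f0 s : (0 <= (f s)%:E)%E by rewrite lee_fin powR_ge0.
apply: (@le_lt_trans _ _
  (\int[mu]_(s in `[0%R, 1%R]) (((C / a) ^+ 2)%:E * (f s)%:E))%E).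
  apply: ge0_le_integral => //.
  - by move=> s _; exact: sq_ge0.
  - by apply: measurable_sq; exact: measurable_fbm_kernel.
  - by apply: measurable_funeM; exact: mf.
  - move=> s /=; rewrite in_itv/= => /andP[s0 s1].
    rewrite -EFinM lee_fin; have [s00|s00] := leP s 0.
      by rewrite fbm_kernelE ltNge s00/= expr0n/= mulr_ge0 ?sqr_ge0 ?powR_ge0.
    have -> : f s = (s `^ (- a)) ^+ 2.
      by rewrite /f subr0 -powR_mulrn ?powR_ge0// -powRrM; congr powR; ring.
    rewrite -exprMn; apply: lerXn2r; rewrite ?nnegrE ?fbm_kernel_ge0//.
      apply: mulr_ge0; last exact: powR_ge0.
      by apply: divr_ge0; [exact: C0|exact: ltW].
    by apply: fbm_kernel1_le; rewrite s00.
rewrite ge0_integralZl//; last by rewrite lee_fin sqr_ge0.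
apply: lte_mul_pinfty => //; first by rewrite lee_fin sqr_ge0.
  by rewrite (le_lt_trans (integral_powR_sub_le p0 ler01))// ltry.
exact: mf.
Qed.

Lemma fbm_kernel_cvg s (l : R^nat) : (forall n, l n < 1) -> l @ \oo --> (1 : R) ->
  K (l n) s @[n --> \oo] --> K 1 s.
Proof.
move=> l1 lcvg; have [s0|s0] := leP s 0.
  under eq_fun do rewrite fbm_kernelE ltNge s0/=.
  by rewrite fbm_kernelE ltNge s0/=; exact: cvg_cst.
have [s1|s1] := leP 1 s.
  under eq_fun => n do rewrite fbm_kernel_eq0 ?(le_trans (ltW (l1 n)))//.
  by rewrite fbm_kernel_eq0//; exact: cvg_cst.
under eq_fun do rewrite fbm_kernelE s0 ltW//=.
rewrite fbm_kernelE s0 lexx/=; apply: cvgM; first exact: cvg_cst.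
have r1 : 1 < 1 / s by rewrite ltr_pdivlMr// mul1r.
apply: (@continuous_cvg _ _ _ _ _ (fun n => l n / s) (fbm_profile a) (1 / s)).
  exact: (fbm_profile_continuous a0 r1).
by apply: cvgM; [exact: lcvg|exact: cvg_cst].
Qed.

(** Dominated convergence: the integrand is at most [K(1, s)^2] because [K] is
    nonnegative and nondecreasing in its first argument. *)
Lemma fbm_kernel_left_continuous e : 0 < e ->
  exists2 l, 0 < l < 1 & (sqnorm 1 (fun s => K 1 s - K l s)%R < e%:E)%E.
Proof.
move=> e0; pose l (n : nat) : R := 1 - n.+2%:R^-1.
have l1 n : l n < 1 by rewrite ltrBlDr ltrDl invr_gt0.
have l0 n : 0 < l n by rewrite subr_gt0 invf_lt1// ltr1n.
have lcvg : l @ \oo --> (1 : R).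
  rewrite -[X in _ --> X]subr0; apply: cvgB; first exact: cvg_cst.
  have := @cvg_harmonic R; rewrite -cvg_shiftS; exact.
have mK t := measurable_fbm_kernel t.
have m01 : measurable (`[0, 1]%classic : set (measurableTypeR R)) by [].
have mf n : measurable_fun (`[0, 1]%classic : set (measurableTypeR R))
    (fun s => ((K 1 s - K (l n) s) ^+ 2)%:E).
  by apply: measurable_sq; exact: measurable_funB.
have intK : mu.-integrable `[0, 1] (fun s => ((K 1 s) ^+ 2)%:E).
  apply/integrableP; split; first exact: measurable_sq.
  under eq_integral do rewrite gee0_abs ?sq_ge0//.
  exact: fbm_kernel1_L2.
have cvg_sq s : ((K 1 s - K (l n) s) ^+ 2)%:E @[n --> \oo] --> 0%E.
  apply: cvg_EFin; first exact: nearW.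
  rewrite [X in _ --> X](_ : _ = (K 1 s - K 1 s) * (K 1 s - K 1 s)); last first.
    by rewrite subrr mulr0.
  under eq_fun do rewrite /= expr2.
  by apply: cvgM; (apply: cvgB; [exact: cvg_cst|exact: fbm_kernel_cvg]).
have dom s n : (`|((K 1 s - K (l n) s) ^+ 2)%:E| <= ((K 1 s) ^+ 2)%:E)%E.
  rewrite gee0_abs ?sq_ge0// lee_fin; apply: lerXn2r.
  - by rewrite nnegrE subr_ge0 fbm_kernel_nd// ltW.
  - by rewrite nnegrE fbm_kernel_ge0.
  - by rewrite gerBl fbm_kernel_ge0.
have [_ _] := @dominated_convergence _ (measurableTypeR R) _ mu _
  m01 _ (fun=> 0%E) _ mf (measurable_cst _) (aeW mu (fun s _ => cvg_sq s)) intK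
  (aeW mu (fun s n _ => dom s n)).
rewrite integral0 => cvg0.
have : \forall n \near \oo, (sqnorm 1 (fun s => K 1 s - K (l n) s)%R < e%:E)%E.
  have nb : nbhs (0%E : \bar R) [set x : \bar R | (x < e%:E)%E].
    by apply: open_ereal_lt'; rewrite lte_fin.
  by move: cvg0 => /(_ _ nb).
case=> N _ /(_ N (leqnn N)) h; exists (l N); last exact: h.
by rewrite l0 l1.
Qed.

End Kernel.

(** * Rescaling and almost minimisers *)

Section Minimax.
Context {R : realType}.
Local Notation mu := (@lebesgue_measure R).
Variable H : R.
Hypothesis hH : 2^-1 < H < 1.
Local Notation a := (H - 2^-1).
Local Notation K := (fbm_kernel H).
Implicit Types (x y z : R -> R) (l t : R).

Let mK t : measurable_fun [set: R] (K t).
Proof. exact: measurable_fbm_kernel. Qed.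

Definition sq_dist x : \bar R :=
  ereal_sup [set sqnorm t (fun s => K t s - x s) | t in `[0, 1]].

Definition square_integrable x :=
  measurable_fun [set: R] x /\ (sqnorm 1 x < +oo)%E.

Lemma le_sq_dist t x : 0 <= t <= 1 ->
  (sqnorm t (fun s => K t s - x s)%R <= sq_dist x)%E.
Proof. by move=> t01; apply: ereal_sup_ubound; exists t; rewrite //= in_itv. Qed.

Lemma sq_dist_le x (c : \bar R) :
  (forall t, 0 <= t <= 1 -> (sqnorm t (fun s => K t s - x s)%R <= c)%E) ->
  (sq_dist x <= c)%E.
Proof.
by move=> h; apply: ge_ereal_sup => _ [t + <-]; rewrite /= in_itv/=; exact: h.
Qed.

Lemma sq_dist_ge0 x : (0 <= sq_dist x)%E.
Proof.
apply: (le_trans (sqnorm_ge0 0 (fun s => K 0 s - x s))).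
by apply: le_sq_dist; rewrite lexx ler01.
Qed.

Lemma fbm_distE x : fbm_dist H x = sqrte (sq_dist x).
Proof.
apply/eqP; rewrite eq_le; apply/andP; split.
  apply: ge_ereal_sup => _ [t + <-]; rewrite /= in_itv/= => t01.
  by rewrite lee_sqrt ?sq_dist_ge0//; exact: le_sq_dist.
have d0 : (0 <= fbm_dist H x)%E.
  apply: (@le_trans _ _ (sqrte (sqnorm 0 (fun s => K 0 s - x s)%R))).
    exact: sqrte_ge0.
  by apply: ereal_sup_ubound; exists 0; rewrite //= in_itv/= lexx ler01.
rewrite -[leRHS](gee0_abs d0) -sqrte_sqr lee_sqrt; last first.
  by rewrite expe2 mule_ge0.
apply: sq_dist_le => t t01.
rewrite -lee_sqrt; last by rewrite expe2 mule_ge0.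
rewrite sqrte_sqr gee0_abs//.
by apply: ereal_sup_ubound; exists t; rewrite //= in_itv.
Qed.

Lemma le_fbm_dist x y :
  (fbm_dist H x <= fbm_dist H y)%E = (sq_dist x <= sq_dist y)%E.
Proof. by rewrite !fbm_distE lee_sqrt// sq_dist_ge0. Qed.

(** The self-similar rescaling of [z], extended by [0] on the part of the
    interval that the dilation does not reach. *)
Definition rescale l z (s : R) : R := if s <= l then l `^ a * z (s / l) else 0.

Lemma measurable_rescale l z : measurable_fun [set: R] z ->
  measurable_fun [set: R] (rescale l z).
Proof.
move=> mz; apply: measurable_fun_ifT => //; first exact: measurable_fun_ler.
apply: measurable_funM => //; apply: (measurableT_comp mz).
exact: measurable_funM.
Qed.

Lemma mul_sqr_powR_shift l : 0 < l -> l * (l `^ a) ^+ 2 = l `^ (2 * H).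
Proof.
move=> l0; rewrite -powR_mulrn ?powR_ge0// -powRrM.
rewrite -{1}(powRr1 (ltW l0)) -powRD ?(gt_eqF l0) ?implybT//.
by congr powR; field.
Qed.

Lemma powR_2H_lt1 l : 0 < l < 1 -> l `^ (2 * H) < 1.
Proof.
move=> /andP[l0 l1]; have H0 : 0 < 2 * H by case/andP : hH; lra.
rewrite [ltRHS](_ : 1 = 1 `^ (2 * H)); last by rewrite powR1.
by apply: (gt0_ltr_powR H0); rewrite ?nnegrE ?ler01 ?(ltW l0).
Qed.

Lemma sqnorm_rescale l z : 0 < l < 1 -> measurable_fun [set: R] z ->
  sqnorm 1 (rescale l z) = ((l `^ (2 * H))%:E * sqnorm 1 z)%E.
Proof.
move=> /andP[l0 l1] mz.
have mr := measurable_rescale l mz.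
rewrite (sqnorm_support mr (ltW l1)); last first.
  by move=> s /andP[ls _]; rewrite /rescale leNgt ls.
rewrite (sqnorm_dilation _ l0)// divff ?gt_eqF//.
rewrite (@eq_sqnorm _ _ _ (fun s => l `^ a * z s)).
  by rewrite sqnormZ// muleA -EFinM mul_sqr_powR_shift.
move=> s /andP[s0 s1]; rewrite /rescale mulrC ler_piMl// ?ltW// mulfK//.
by rewrite gt_eqF.
Qed.

(** Self-similarity turns the distance at time [t] into that of [z] at time
    [t / l], with the factor [l] of the dilation and [l^(2 H - 1)] of the square
    of the kernel. *)
Lemma sqnorm_rescale_below l t z : 0 < l < 1 -> 0 <= t <= l ->
  measurable_fun [set: R] z ->
  sqnorm t (fun s => K t s - rescale l z s) =
  ((l `^ (2 * H))%:E * sqnorm (t / l) (fun s => K (t / l) s - z s)%R)%E.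
Proof.
move=> /andP[l0 l1] /andP[t0 tl] mz.
have mr := measurable_rescale l mz.
have mKz u : measurable_fun [set: R] (fun s => K u s - z s).
  exact: measurable_funB.
rewrite (sqnorm_dilation _ l0); last exact: measurable_funB.
rewrite (@eq_sqnorm _ _ _ (fun s => l `^ a * (K (t / l) s - z s))).
  by rewrite sqnormZ// muleA -EFinM mul_sqr_powR_shift.
move=> s /andP[s0 st].
have tE : t = l * (t / l) by field; rewrite gt_eqF.
have tl1 : t / l <= 1 by rewrite ler_pdivrMr// mul1r.
have l01' : 0 < l <= 1 by rewrite l0 ltW.
rewrite [X in K X _]tE (fbm_kernel_selfsimilar hH _ l01' tl1).
rewrite /rescale mulrBr; congr (_ - _).
have -> : l * s <= l.
  by rewrite ger_pMr// (le_trans st).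
by rewrite [l * s]mulrC mulfK// gt_eqF.
Qed.

(** Beyond [l] the kernel [K(l, .)] and the rescaled function both vanish, so the
    distance between them is the one at time [l], which is at most that of [z] at
    time [1]; the remaining error [K(t, .) - K(l, .)] is largest at [t = 1] by
    monotonicity. *)
Lemma sqnorm_rescale_above l t z e : 0 < l < 1 -> l <= t <= 1 -> 0 < e ->
  measurable_fun [set: R] z ->
  (sqnorm t (fun s => K t s - rescale l z s)%R <=
   (1 + e^-1)%:E * sqnorm 1 (fun s => K 1 s - K l s)%R +
   (1 + e)%:E * sqnorm 1 (fun s => K 1 s - z s)%R)%E.
Proof.
move=> l01 /andP[lt t1] e0 mz; have /andP[l0 l1] := l01.
have mr := measurable_rescale l mz.
have mKr u : measurable_fun [set: R] (fun s => K u s - rescale l z s).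
  exact: measurable_funB.
have mKK u v : measurable_fun [set: R] (fun s => K u s - K v s).
  exact: measurable_funB.
apply: le_trans (sqnorm_subset (mKr t) t1) _.
rewrite (@eq_sqnorm _ _ _
  (fun s => (K t s - K l s) + (K l s - rescale l z s))); last first.
  by move=> s _; ring.
apply: le_trans (sqnorm_young _ e0 (mKK _ _) (mKr _)) _.
have ei0 : 0 < e^-1 by rewrite invr_gt0.
apply: leeD; apply: lee_wpmul2l.
- by rewrite lee_fin addr_ge0// ltW.
- apply: le_sqnorm => // s _.
  have h : K l s <= K t s by rewrite fbm_kernel_nd.
  apply: lerXn2r; rewrite ?nnegrE ?subr_ge0//.
  + by rewrite fbm_kernel_nd// ltW.
  + by rewrite lerD2r fbm_kernel_nd.
- by rewrite lee_fin addr_ge0// ltW.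
- rewrite (sqnorm_support (mKr l) (ltW l1)); last first.
    move=> s /andP[ls _].
    by rewrite fbm_kernel_eq0 ?ltW// /rescale leNgt ls/= subr0.
  rewrite sqnorm_rescale_below ?lexx ?(ltW l0)// divff ?gt_eqF//.
  rewrite gee_pMl ?sqnorm_ge0// lee_fin.
  exact/ltW/powR_2H_lt1.
Qed.

Lemma sq_dist_rescale l z e (M A w : R) : 0 < l < 1 -> 0 < e ->
  measurable_fun [set: R] z ->
  (sq_dist z <= M%:E)%E -> (sqnorm 1 (fun s => K 1 s - z s)%R <= A%:E)%E ->
  (sqnorm 1 (fun s => K 1 s - K l s)%R <= w%:E)%E ->
  (sq_dist (rescale l z) <=
   (Num.max (l `^ (2 * H) * M) ((1 + e^-1) * w + (1 + e) * A))%:E)%E.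
Proof.
move=> l01 e0 mz zM zA Kw; have /andP[l0 l1] := l01.
have ei0 : 0 < e^-1 by rewrite invr_gt0.
apply: sq_dist_le => t /andP[t0 t1].
rewrite EFin_max le_max; have [tl|lt] := leP t l.
  rewrite sqnorm_rescale_below ?t0// EFinM lee_wpmul2l ?lee_fin ?powR_ge0//.
  apply: le_trans zM; apply: le_sq_dist.
  by rewrite divr_ge0 ?(ltW l0)//= ler_pdivrMr// mul1r.
apply/orP; right.
apply: (le_trans (sqnorm_rescale_above l01 _ e0 mz)); first by rewrite (ltW lt).
by rewrite [leRHS]EFinD !EFinM leeD// lee_wpmul2l// lee_fin addr_ge0// ltW.
Qed.

Variable m : R.
Hypothesis m_lb : forall z, square_integrable z -> (m%:E <= sq_dist z)%E.

(** If an almost minimiser had a squared distance at time [1] below [m] by a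
    fixed amount, rescaling it would beat the infimum: the factor [l^(2 H) < 1]
    improves all times up to [l], and the later times have room to spare. The
    parameter [l] depends only on [A], which makes the gap uniform in [z]. *)
Lemma endpoint_gap (A : R) : A < m ->
  exists2 e, 0 < e & forall z, square_integrable z ->
    (sq_dist z <= (m + e)%:E)%E ->
    (A%:E < sqnorm 1 (fun s => K 1 s - z s)%R)%E.
Proof.
move=> Am; have [A0|A0] := ltP A 0.
  exists 1 => // z _ _; apply: lt_le_trans (sqnorm_ge0 _ _).
  by rewrite lte_fin.
have m0 : 0 < m := le_lt_trans A0 Am.
(* [e] is such that [(1 + e) A <= (m + A) / 2], and [w] such that
   [(1 + 1 / e) w] takes up only half of what is left below [m]. *)
pose e := (m - A) / (2 * m).
have e0 : 0 < e by rewrite divr_gt0 ?subr_gt0// mulr_gt0.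
have ei0 : 0 < 1 + e^-1 by rewrite addr_gt0// invr_gt0.
pose w := (m - A) / 4 / (1 + e^-1).
have w0 : 0 < w by rewrite !divr_gt0// subr_gt0.
have [l l01 Kw] := fbm_kernel_left_continuous hH w0.
have /andP[l0 l1] := l01.
pose q := l `^ (2 * H).
have q0 : 0 < q by rewrite powR_gt0.
have q1 : q < 1.
  exact: powR_2H_lt1.
(* Half of the excess for which [q (m + excess) = m]. *)
exists (m * (q^-1 - 1) / 2).
  by rewrite divr_gt0// mulr_gt0// subr_gt0 invf_gt1.
move=> z [mz z2] zm; rewrite ltNge; apply/negP => zA.
have := sq_dist_rescale l01 e0 mz zm zA (ltW Kw).
have Lr : square_integrable (rescale l z).
  split; first exact: measurable_rescale.
  by rewrite sqnorm_rescale// lte_mul_pinfty// lee_fin powR_ge0.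
move=> /(le_trans (m_lb Lr)); rewrite lee_fin -/q le_max => /orP[].
  rewrite (_ : q * _ = m - m * (1 - q) / 2); last by field; rewrite gt_eqF.
  by rewrite leNgt gtrBl divr_gt0// mulr_gt0// subr_gt0.
have -> : (1 + e^-1) * w = (m - A) / 4 by rewrite /w mulrC divfK// gt_eqF.
have eA : e * A <= (m - A) / 2.
  rewrite (_ : (m - A) / 2 = e * m); last by rewrite /e; field; rewrite gt_eqF.
  by rewrite ler_wpM2l// ltW.
by move: eA Am; lra.
Qed.

Lemma midpoint_square_integrable x y :
  square_integrable x -> square_integrable y ->
  square_integrable (fun s => (x s + y s) / 2).
Proof.
move=> [mx x2] [my y2].
have mxy : measurable_fun [set: R] (fun s => x s + y s) by exact: measurable_funD.
split; first exact: measurable_funM.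
rewrite (@eq_sqnorm _ _ _ (fun s => 2^-1 * (x s + y s))); last first.
  by move=> s _; rewrite mulrC.
rewrite sqnormZ// lte_mul_pinfty ?lee_fin ?sqr_ge0//.
apply: (le_lt_trans (sqnorm_young _ ltr01 mx my)).
by rewrite lte_add_pinfty// lte_mul_pinfty// lee_fin; lra.
Qed.

(** The midpoint is an almost minimiser, so by [endpoint_gap] it leaves little
    room at time [1] for the term [1/4 \int_0^1 (x - y)^2] of the parallelogram
    identity. *)
Lemma near_minimizers_close (d : R) : 0 < d ->
  exists2 e, 0 < e & forall x y, square_integrable x -> square_integrable y ->
    (sq_dist x <= (m + e)%:E)%E -> (sq_dist y <= (m + e)%:E)%E ->
    (sqnorm 1 (fun s => x s - y s)%R <= d%:E)%E.
Proof.
move=> d0; have Am : m - d / 8 < m by rewrite gtrBl divr_gt0.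
have [e0 e00 gap] := endpoint_gap Am.
exists (Num.min e0 (d / 8)); first by rewrite lt_min e00 divr_gt0.
set e := Num.min _ _ => x y Lx Ly xm ym.
have [[mx x2] [my y2]] := (Lx, Ly).
pose z s := (x s + y s) / 2.
have mid t : 0 <= t <= 1 -> (sqnorm t (fun s => K t s - z s)%R +
    4^-1%:E * sqnorm t (fun s => x s - y s)%R <= (m + e)%:E)%E.
  move=> t01; rewrite sqnorm_midpoint//.
  rewrite (_ : m + e = 2^-1 * ((m + e) + (m + e))); last by field.
  rewrite EFinM lee_wpmul2l// EFinD leeD//.
    exact: le_trans (le_sq_dist _ t01) xm.
  exact: le_trans (le_sq_dist _ t01) ym.
have zm : (sq_dist z <= (m + e)%:E)%E.
  apply: sq_dist_le => t t01; apply: le_trans (mid _ t01).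
  by rewrite leeDl// mule_ge0// sqnorm_ge0.
have := gap z (midpoint_square_integrable Lx Ly).
have ee0 : m + e <= m + e0 by rewrite lerD2l ge_min lexx.
rewrite -lee_fin in ee0; move=> /(_ (le_trans zm ee0)).
have ed : e <= d / 8 by rewrite ge_min lexx orbT.
have := mid 1; rewrite ler01 lexx => /(_ isT).
have := sqnorm_ge0 1 (fun s => K 1 s - z s).
have := sqnorm_ge0 1 (fun s => x s - y s).
case: (sqnorm 1 (fun s => x s - y s)) => [S| |] //; last first.
  by case: (sqnorm _ _) => [S'| |] //= _ _; rewrite gt0_muley// lte_fin invr_gt0.
case: (sqnorm _ _) => [S'| |] //=; rewrite -EFinM -EFinD !lee_fin lte_fin.
by move: ed; lra.
Qed.

End Minimax.

(** * Completeness *)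

Section Completeness.
Context {R : realType}.
Local Notation mu := (@lebesgue_measure R).
Implicit Types (x : nat -> R -> R) (k y : R -> R) (t c : R).

(** The increments are dominated by a geometric series of ratio [2^(-1/2)]. *)
Lemma geometric_increments_cvg (u : R^nat) c :
  (forall n, 2 ^+ n * (u n.+1 - u n) ^+ 2 <= c) -> cvgn u.
Proof.
move=> uc.
have c0 : 0 <= c.
  by apply: le_trans (uc 0); rewrite mulr_ge0 ?sqr_ge0 ?exprn_ge0.
pose r : R := Num.sqrt 2^-1.
have r0 : 0 <= r by exact: sqrtr_ge0.
have r2 : r ^+ 2 = 2^-1 by rewrite sqr_sqrtr.
have r1 : `|r| < 1.
  by rewrite ger0_norm// -(@ltr_pXn2r _ 2)// ?nnegrE// r2 expr1n; lra.
have bound n : `|telescope u n| <= geometric (Num.sqrt c) r n.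
  rewrite /telescope /geometric /= -(@ler_pXn2r _ 2)// ?nnegrE//; last first.
    by rewrite mulr_ge0 ?sqrtr_ge0 ?exprn_ge0.
  rewrite real_normK ?num_real// exprMn sqr_sqrtr// -exprM mulnC exprM r2.
  by rewrite exprVn ler_pdivlMr ?exprn_gt0// mulrC.
have : cvgn (series (telescope u)).
  apply: normed_cvg; apply: (@series_le_cvg _ _ (geometric (Num.sqrt c) r)) => //.
  - by move=> n; apply: normr_ge0.
  - by move=> n; apply: geometric_ge0; rewrite ?sqrtr_ge0.
  - exact: is_cvg_geometric_series.
move=> h.
have -> : u = (fun n => u 0 + series (telescope u) n).
  by apply/funext => n; exact: eq_sum_telescope.
by apply: is_cvgD => //; exact: is_cvg_cst.
Qed.

(** The series of [2^n (x_(n+1) - x_n)^2] has a finite integral, so it is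
    finite, hence has bounded terms, almost everywhere. *)
Lemma sqnorm_cauchy_ae_cvg x : (forall n, measurable_fun [set: R] (x n)) ->
  (forall n, (sqnorm 1 (fun s => x n.+1 s - x n s)%R <= (4^-1 ^+ n)%:E)%E) ->
  {ae mu, forall s, 0 <= s <= 1 -> cvgn (x ^~ s)}.
Proof.
move=> mx xx.
pose g n s : \bar R := ((2 ^+ n)%:E * ((x n.+1 s - x n s) ^+ 2)%:E)%E.
have g0 n s : (0 <= g n s)%E by rewrite mule_ge0// ?sq_ge0// lee_fin exprn_ge0.
have md n : measurable_fun [set: R] (fun s => x n.+1 s - x n s).
  exact: measurable_funB.
have m01 : measurable (`[0, 1]%classic : set (measurableTypeR R)) by [].
have mg n : measurable_fun (`[0, 1]%classic : set (measurableTypeR R)) (g n).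
  by apply: measurable_funeM; exact: measurable_sq.
have ig : mu.-integrable `[0, 1] (fun s => \sum_(0 <= n <oo) g n s)%E.
  apply/integrableP; split.
    exact: (@ge0_emeasurable_sum _ (measurableTypeR R) _ _ g xpredT
      (fun n s _ _ => g0 n s) (fun n _ => mg n)).
  under eq_integral do rewrite gee0_abs ?nneseries_ge0//.
  rewrite integral_nneseries//.
  apply: (@le_lt_trans _ _ 2%:E); last exact: ltry.
  apply: le_trans (@epsilon_trick0 R 2 xpredT _) => //.
  apply: lee_nneseries => n _; first by move=> _; exact: integral_ge0.
  rewrite ge0_integralZl//; last 2 first.
  - exact: measurable_sq.
  - by move=> s _; exact: sq_ge0.
  apply: (@le_trans _ _ ((2 ^+ n)%:E * (4^-1 ^+ n)%:E)%E).
    by apply: lee_wpmul2l; [rewrite lee_fin exprn_ge0|exact: xx].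
  rewrite -EFinM lee_fin natrX exprS invfM mulrA divff// mul1r.
  rewrite -exprMn (_ : 2 * 4^-1 = 2^-1 :> R); last by field.
  by rewrite exprVn.
have := integrable_ae m01 ig.
apply: (@filterS _ _ (ae_filter_ringOfSetsType mu)) => s /= fin s01.
have /fin gfin : s \in `[0, 1] by rewrite in_itv.
apply: (@geometric_increments_cvg _ (fine (\sum_(0 <= n <oo) g n s))%E) => n.
rewrite -lee_fin fineK// EFinM.
have := @nneseries_lim_ge R (g^~ s) xpredT 0 n.+1 (fun n _ _ => g0 n s).
apply: le_trans; rewrite big_mkord big_ord_recr/= leeDr//.
by apply: sume_ge0.
Qed.

Lemma sqnorm_fatou t k x y (v : R^nat) c : measurable_fun [set: R] k ->
  (forall n, measurable_fun [set: R] (x n)) -> measurable_fun [set: R] y ->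
  {ae mu, forall s, 0 <= s <= t -> x ^~ s @ \oo --> y s} ->
  (forall n, (sqnorm t (fun s => k s - x n s)%R <= (v n)%:E)%E) ->
  v @ \oo --> c -> (sqnorm t (fun s => k s - y s)%R <= c%:E)%E.
Proof.
move=> mk mx my xy xv vc.
have mkx n : measurable_fun [set: R] (fun s => k s - x n s).
  exact: measurable_funB.
have mky : measurable_fun [set: R] (fun s => k s - y s).
  exact: measurable_funB.
have m0t : measurable (`[0, t]%classic : set (measurableTypeR R)) by [].
pose f n (s : measurableTypeR R) : \bar R := ((k s - x n s) ^+ 2)%:E.
have mf n : measurable_fun (`[0, t]%classic : set (measurableTypeR R)) (f n).
  exact: measurable_sq.
have f0 n s : `[0, t]%classic s -> (0 <= f n s)%E by move=> _; exact: sq_ge0.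
have -> : sqnorm t (fun s => k s - y s) =
    (\int[mu]_(s in `[0%R, t]) limn_einf (f ^~ s))%E.
  apply: ge0_ae_eq_integral => //.
  - exact: measurable_sq.
  - rewrite (_ : (fun s => _) = (fun s => - limn_esup (-%E \o f ^~ s))%E).
      apply: measurableT_comp => //; apply: measurable_fun_limn_esup => n.
      by apply: measurableT_comp => //; exact: mf.
    by apply/funext => s; rewrite limn_esupN oppeK.
  - by move=> s _; exact: sq_ge0.
  - move=> s _; rewrite limn_einf_lim; apply: lime_ge; first exact: is_cvg_einfs.
    by apply: nearW => n; apply: le_ereal_inf_tmp => _ [j _ <-]; exact: sq_ge0.
  - move: xy; apply: (@filterS _ _ (ae_filter_ringOfSetsType mu)) => s /= xy.
    rewrite in_itv/= => /xy {}xy; apply/esym.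
    have h : f ^~ s @ \oo --> ((k s - y s) ^+ 2)%:E.
      apply: cvg_EFin; first exact: nearW.
      rewrite expr2; under eq_fun do rewrite /f /= expr2.
      by apply: cvgM; (apply: cvgB; [exact: cvg_cst|exact: xy]).
    by rewrite (cvg_limn_einf_sup h).1.
apply: le_trans (fatou mu m0t mf f0) _.
have vcE : EFin \o v @ \oo --> c%:E by apply: cvg_EFin => //; exact: nearW.
rewrite limn_einf_lim -(cvg_lim _ vcE)//; apply: lee_lim.
- exact: is_cvg_einfs.
- by apply/cvg_ex; exists c%:E.
- apply: nearW => n; apply: le_trans (xv n).
  by apply: ereal_inf_lbound; exists n => /=.
Qed.

End Completeness.

(** * Existence and uniqueness among functions *)

Section Minimizer.
Context {R : realType}.
Local Notation mu := (@lebesgue_measure R).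
Variable H : R.
Hypothesis hH : 2^-1 < H < 1.
Local Notation K := (fbm_kernel H).
Local Notation sq_dist := (@sq_dist R H).
Implicit Types (x y z : R -> R).

Lemma ae_eq_sq_dist x y : measurable_fun [set: R] x -> measurable_fun [set: R] y ->
  {ae mu, forall s, 0 <= s <= 1 -> x s = y s} -> sq_dist x = sq_dist y.
Proof.
move=> mx my xy; congr ereal_sup; apply: eq_imagel => t /=.
rewrite in_itv/= => /andP[t0 t1].
have mK := measurable_fbm_kernel hH t.
apply: ae_eq_sqnorm; [exact: measurable_funB|exact: measurable_funB|].
move: xy; apply: (@filterS _ _ (ae_filter_ringOfSetsType mu)) => s /= xy.
by move=> /andP[s0 st]; rewrite xy// s0 (le_trans st).
Qed.

Lemma square_integrable0 : square_integrable (fun=> 0%R : R).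
Proof. by split; [exact: measurable_cst|rewrite sqnorm0 ltry]. Qed.

Lemma sq_dist0_lty : (sq_dist (fun=> 0%R) < +oo)%E.
Proof.
have mK t := measurable_fbm_kernel hH t.
apply: le_lt_trans (fbm_kernel1_L2 hH); apply: sq_dist_le => t /andP[t0 t1].
rewrite (@eq_sqnorm _ _ _ (K t)); last by move=> s _; rewrite subr0.
apply: le_trans (sqnorm_subset (mK t) t1) _; apply: le_sqnorm => // s _.
by apply: lerXn2r; rewrite ?nnegrE ?fbm_kernel_ge0// fbm_kernel_nd.
Qed.

Lemma sq_dist_infimum : exists m : R,
  (forall z, square_integrable z -> (m%:E <= sq_dist z)%E) /\
  (forall e, 0 < e -> exists2 x, square_integrable x & (sq_dist x <= (m + e)%:E)%E).
Proof.
pose S := [set sq_dist z | z in @square_integrable R].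
have inf0 : (0 <= ereal_inf S)%E.
  by apply: le_ereal_inf_tmp => _ [z _ <-]; exact: sq_dist_ge0.
have infy : (ereal_inf S < +oo)%E.
  apply: le_lt_trans sq_dist0_lty; apply: ereal_inf_lbound.
  by exists (fun=> 0) => //; exact: square_integrable0.
have fin : ereal_inf S \is a fin_num by rewrite ge0_fin_numE.
exists (fine (ereal_inf S)); split=> [z Lz|e e0].
  by rewrite fineK//; apply: ereal_inf_lbound; exists z.
have [_ [x Lx <-] /ltW xe] := lb_ereal_inf_adherent e0 fin.
by exists x => //; rewrite EFinD fineK.
Qed.

Lemma square_integrable_of_sq_dist y : measurable_fun [set: R] y ->
  (sq_dist y < +oo)%E -> square_integrable y.
Proof.
move=> my ylty; have mK := measurable_fbm_kernel hH 1.
split => //.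
rewrite (@eq_sqnorm _ _ _ (fun s => K 1 s + - (K 1 s - y s))); last first.
  by move=> s _; ring.
have mKy : measurable_fun [set: R] (fun s => K 1 s - y s) by exact: measurable_funB.
apply: (le_lt_trans (sqnorm_young _ ltr01 mK (measurable_funN mKy))).
rewrite sqnormN; apply: lte_add_pinfty; apply: lte_mul_pinfty => //.
- exact: fbm_kernel1_L2.
- by apply: le_lt_trans ylty; apply: le_sq_dist; rewrite ler01 lexx.
Qed.

Lemma sq_dist_minimizer_exists : exists2 y, square_integrable y &
  forall z, square_integrable z -> (sq_dist y <= sq_dist z)%E.
Proof.
have [m [mlb minf]] := sq_dist_infimum.
have mK t := measurable_fbm_kernel hH t.
have /choice[e eP] (n : nat) : exists e : R, 0 < e /\
    forall x y, square_integrable x -> square_integrable y ->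
    (sq_dist x <= (m + e)%:E)%E -> (sq_dist y <= (m + e)%:E)%E ->
    (sqnorm 1 (fun s => x s - y s)%R <= (4^-1 ^+ n)%:E)%E.
  have d0 : 0 < 4^-1 ^+ n :> R by rewrite exprn_gt0.
  by have [e e0 eP] := near_minimizers_close hH mlb d0; exists e.
(* The increment from [x n] to [x n.+1] is controlled by [e n], so [x n] must
   be [e n]-minimal and [e n.-1]-minimal. *)
pose d (n : nat) := Num.min (n.+1%:R^-1) (Num.min (e n) (e n.-1)).
have d0 n : 0 < d n by rewrite !lt_min invr_gt0 ltr0n (eP n).1 (eP n.-1).1.
have /choice[x xP] (n : nat) : exists x, square_integrable x /\
    (sq_dist x <= (m + d n)%:E)%E.
  by have [x Lx xm] := minf _ (d0 n); exists x.
have mx n : measurable_fun [set: R] (x n) by have [[]] := xP n.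
have xle n c : d n <= c -> (sq_dist (x n) <= (m + c)%:E)%E.
  by move=> dc; apply: le_trans (xP n).2 _; rewrite lee_fin lerD2l.
have xcvg : {ae mu, forall s, 0 <= s <= 1 -> cvgn (x ^~ s)}.
  apply: sqnorm_cauchy_ae_cvg => // n; apply: (eP n).2.
  - exact: (xP n.+1).1.
  - exact: (xP n).1.
  - by apply: xle; rewrite /d /= !ge_min lexx !orbT.
  - by apply: xle; rewrite /d /= !ge_min lexx !orbT.
(* The upper limit agrees with the limit where the latter exists, and is
   measurable everywhere. *)
pose y s := fine (limn_esup (fun n => (x n s)%:E)).
have my : measurable_fun [set: R] y.
  apply: measurableT_comp => //.
  by apply: measurable_fun_limn_esup => n; apply/measurable_EFinP.
have xy : {ae mu, forall s, 0 <= s <= 1 -> x ^~ s @ \oo --> y s}.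
  move: xcvg; apply: (@filterS _ _ (ae_filter_ringOfSetsType mu)) => s /= xs.
  move=> /xs cx.
  have h : (fun n => (x n s)%:E) @ \oo --> (limn (x ^~ s))%:E.
    by apply: cvg_EFin; [exact: nearW|exact: cx].
  by rewrite /y (cvg_limn_einf_sup h).2/=.
have ym : (sq_dist y <= m%:E)%E.
  apply: sq_dist_le => t /andP[t0 t1].
  apply: (@sqnorm_fatou _ _ _ x _ (fun n => m + n.+1%:R^-1)) => //.
  - move: xy; apply: (@filterS _ _ (ae_filter_ringOfSetsType mu)) => s /= xy.
    by move=> /andP[s0 st]; apply: xy; rewrite s0 (le_trans st).
  - move=> n; apply: le_trans (xle n _ _).
      by apply: le_sq_dist; rewrite t0.
    by rewrite /d ge_min lexx.
  - rewrite -[X in _ --> X]addr0; apply: cvgD; first exact: cvg_cst.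
    exact: cvg_harmonic.
exists y.
  by apply: square_integrable_of_sq_dist => //; apply: le_lt_trans ym _; exact: ltry.
by move=> z Lz; apply: le_trans ym (mlb z Lz).
Qed.

Lemma sq_dist_minimizer_unique x y :
  square_integrable x -> square_integrable y ->
  (forall z, square_integrable z -> (sq_dist x <= sq_dist z)%E) ->
  (forall z, square_integrable z -> (sq_dist y <= sq_dist z)%E) ->
  {ae mu, forall s, 0 <= s <= 1 -> x s = y s}.
Proof.
move=> Lx Ly xmin ymin; have [m [mlb minf]] := sq_dist_infimum.
have mxy : measurable_fun [set: R] (fun s => x s - y s).
  by apply: measurable_funB; [exact: Lx.1|exact: Ly.1].
have xy0 : sqnorm 1 (fun s => x s - y s) = 0%E.
  apply/eqP; rewrite eq_le sqnorm_ge0 andbT; apply/lee_addgt0Pr => d d0.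
  rewrite add0e; have [e e0 eP] := near_minimizers_close hH mlb d0.
  have [z Lz zm] := minf e e0.
  by apply: eP => //;
    [exact: le_trans (xmin z Lz) zm|exact: le_trans (ymin z Lz) zm].
have := sqnorm_eq0 mxy xy0.
apply: (@filterS _ _ (ae_filter_ringOfSetsType mu)) => s /= h /h /eqP.
by rewrite subr_eq0 => /eqP.
Qed.

End Minimizer.

(** * Functions and elements of [L^2] *)

Section L2.
Context {R : realType}.
Local Notation mu := (@lebesgue_measure R).

Lemma lebesgue01E (A : set R) : lebesgue01 R A = mu (A `&` `[0, 1]).
Proof. by []. Qed.

Lemma integral_lebesgue01 (f : R -> \bar R) : measurable_fun [set: R] f ->
  (forall s, (0 <= f s)%E) ->
  (\int[lebesgue01 R]_s f s = \int[mu]_(s in `[0%R, 1%R]) f s)%E.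
Proof.
move=> mf f0.
have m01 : measurable (`[0, 1]%classic : set (measurableTypeR R)) by [].
rewrite (@ge0_negligible_integral _ _ _ (lebesgue01 R) setT (~` `[0, 1]%classic))//.
- rewrite setTD setCK; apply: eq_measure_integral => A mA A01.
  by rewrite lebesgue01E setIidl.
- exact: measurableC.
- by rewrite lebesgue01E setICl measure0.
Qed.

Lemma ae_lebesgue01 (f g : R -> R) : (f = g %[ae lebesgue01 R]) <->
  {ae mu, forall s, 0 <= s <= 1 -> f s = g s}.
Proof.
have m01 : measurable (`[0, 1]%classic : set (measurableTypeR R)) by [].
split=> -[A [mA A0 fgA]].
  exists (A `&` `[0, 1]); split; [exact: measurableI|by rewrite -lebesgue01E|].
  move=> s /= /not_implyP[s01 fg]; split; last by rewrite in_itv.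
  by apply: fgA => /= /(_ I).
exists (A `|` ~` `[0, 1]); split.
- by apply: measurableU => //; exact: measurableC.
- rewrite lebesgue01E setIUl setICl setU0.
  by apply: (subset_measure0 _ mA) => //; exact: measurableI.
- move=> s /= /not_implyP[_ fg].
  have [s01|] := pselect (`[0, 1]%classic s); last by right.
  by left; apply: fgA => /= h; apply: fg; apply: h; move: s01; rewrite /= in_itv.
Qed.

(** The exponent in the definition of the norm is a real power, whence the
    passage through [powR]. *)
Lemma finite_norm_lebesgue01 (f : R -> R) : measurable_fun [set: R] f ->
  finite_norm (lebesgue01 R) 2 f <-> (sqnorm 1 f < +oo)%E.
Proof.
move=> mf; rewrite /finite_norm unlock.
rewrite (eq_integral (fun s : measurableTypeR R => (f s ^+ 2)%:E)); last first.
  move=> s _ /=; rewrite ?poweR_EFin powR_mulrn//; congr EFin.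
  by rewrite real_normK// num_real.
rewrite integral_lebesgue01; [|exact: measurable_sq|by move=> s; exact: sq_ge0].
rewrite -/(sqnorm 1 f); split; first exact: lty_poweRy.
exact: poweR_lty.
Qed.

Lemma L2_01_square_integrable (x : L2_01 R) : square_integrable x.
Proof.
have mx : measurable_fun [set: R] x.
  exact: (@measurable_funPT _ _ _ _ (repr
    (x : {mfun_ (lebesgue01 R), measurableTypeR R >-> measurableTypeR R}))).
by split => //; apply/(finite_norm_lebesgue01 mx); exact: Lebesgue_finite.
Qed.

Local Notation M := (measurableTypeR R).
Local Notation Q := {mfun_ (lebesgue01 R), M >-> M}.
Local Open Scope quotient_scope.

Lemma L2_01_ext (x y : L2_01 R) :
  {ae mu, forall s, 0 <= s <= 1 -> x s = y s} -> x = y.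
Proof.
move=> /ae_lebesgue01 xy.
have {xy} : (x : Q) = (y : Q).
  rewrite -[LHS]reprK -[RHS]reprK; apply/eqP; exact/(@ae_eqP _ _ R M M).
case: x y => [x [[px]]] [y [[py]]] /= xy.
by subst y; rewrite (Prop_irrelevance px py).
Qed.

Lemma L2_01_of_square_integrable (f : R -> R) : square_integrable f ->
  exists x : L2_01 R, {ae mu, forall s, 0 <= s <= 1 -> x s = f s}.
Proof.
move=> [mf f2].
have mf' : @measurable_fun _ _ M M setT f by [].
pose fm : {mfun M >-> M} :=
  HB.pack (f : M -> M) (isMeasurableFun.Build _ _ M M f mf').
pose q : Q := \pi_Q fm.
have qf : (q : M -> M) = fm %[ae lebesgue01 R].
  have : repr q = fm %[mod Q] by rewrite reprK.
  by move/eqP; rewrite eqmodE => /asboolP.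
have mq : measurable_fun [set: R] (q : M -> M).
  exact: (@measurable_funPT _ _ _ _ (repr q)).
have q2 : finite_norm (lebesgue01 R) 2 (q : M -> M).
  apply/(finite_norm_lebesgue01 mq).
  by rewrite (@ae_eq_sqnorm _ _ _ f)//; apply/ae_lebesgue01.
pose x : L2_01 R :=
  HB.pack q (isFinLebesgue.Build _ M R (lebesgue01 R) 2%:E (lee1n 2) q q2).
by exists x; exact/ae_lebesgue01.
Qed.

(** Minimality over [L^2] classes amounts to minimality over square integrable
    functions, since [sq_dist] is the same for every representative. *)
Lemma fbm_dist_minimizerP (H : R) (hH : 2^-1 < H < 1) (a : L2_01 R) :
  (forall x : L2_01 R, (fbm_dist H a <= fbm_dist H x)%E) <->
  (forall z, square_integrable z -> (sq_dist H a <= sq_dist H z)%E).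
Proof.
split=> [amin z Lz|amin x]; last first.
  by rewrite le_fbm_dist; apply: amin; exact: L2_01_square_integrable.
have [x xz] := L2_01_of_square_integrable Lz.
rewrite -(ae_eq_sq_dist hH _ _ xz) -?le_fbm_dist//; last exact: Lz.1.
exact: (L2_01_square_integrable x).1.
Qed.

End L2.

Theorem theorem3 (R : realType) (H : R) (hH : 2^-1 < H < 1) :
  exists! a : L2_01 R,
    forall x : L2_01 R, (fbm_dist H a <= fbm_dist H x)%E.
Proof.
have [y Ly ymin] := sq_dist_minimizer_exists hH.
have [a ay] := L2_01_of_square_integrable Ly.
have aE : sq_dist H a = sq_dist H y.
  apply: (ae_eq_sq_dist hH _ _ ay); last exact: Ly.1.
  exact: (L2_01_square_integrable a).1.
have amin z : square_integrable z -> (sq_dist H a <= sq_dist H z)%E.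
  by rewrite aE; exact: ymin.
exists a; split; first exact/(fbm_dist_minimizerP hH).
move=> b /(fbm_dist_minimizerP hH) bmin; apply: L2_01_ext.
by apply: (sq_dist_minimizer_unique hH) => //; exact: L2_01_square_integrable.
Qed.
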